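(* Let $\{\varepsilon_k\}\subseteq[0,\infty)$ be a null sequence, and let $\{x^k\}$ be a sequence generated by the elastically safeguarded augmented Lagrangian algorithm (described in the context) applied to (NLP) such that $\|\nabla_x \mathcal L_{\upsilon_k}(x^k,\hat\mu^k,\hat\lambda^k)\|\le\varepsilon_k$ holds for each $k\in\mathbb N$. Let $\bar x$ be an accumulation point of $\{x^k\}$ which is feasible for (NLP). Then $\bar x$ is an approximately stationary point of (NLP).
   Context: Problem (NLP): minimize $f(x)$ subject to $g(x)\le 0$, $h(x)=0$, where $f\colon\mathbb R^n\to\mathbb R$, $g\colon\mathbb R^n\to\mathbb R^m$, $h\colon\mathbb R^n\to\mathbb R^\ell$ are continuously differentiable. $\|\cdot\|$ is the Euclidean norm; $\max,\min$ of vectors are componentwise; $\mathbb N$ includes $0$. Lagrangian: $L(x,\mu,\lambda)=f(x)+\langle\mu,g(x)\rangle+\langle\lambda,h(x)\rangle$. Augmented Lagrangian for $\upsilon>0$: $\mathcal L_\upsilon(x,\mu,\lambda)=f(x)+\frac1{2\upsilon}\|\max\{0,g(x)+\upsilon\mu\}\|^2+\frac1{2\upsilon}\|h(x)+\upsilon\lambda\|^2$. Elastically safeguarded augmented Lagrangian algorithm. Data: $\upsilon_0>0$; nonempty compact sets $Y^g\subseteq\mathbb R^m$, $Y^h\subseteq\mathbb R^\ell$; $\tau,\gamma\in(0,1)$; $\eta\in(\gamma,\sqrt\gamma)$; tolerances $\varepsilon_k\ge0$. Set $V_{-1}=+\infty$, $\varrho_0=1$. For $k=0,1,2,\dots$ (no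 termination): (1) select any $\hat\mu^k\in\varrho_kY^g$ and $\hat\lambda^k\in\varrho_kY^h$; (2) find $x^k\in\mathbb R^n$, an $\varepsilon_k$-approximate solution of minimizing $\mathcal L_{\upsilon_k}(\cdot,\hat\mu^k,\hat\lambda^k)$ over $\mathbb R^n$ (the precise sense is the one specified in the claim); (3) set $z^k=\min\{0,g(x^k)+\upsilon_k\hat\mu^k\}$ and $V_k=\max\{\|g(x^k)-z^k\|,\|h(x^k)\|\}$; (4) set $\mu^k=\hat\mu^k+[g(x^k)-z^k]/\upsilon_k$ and $\lambda^k=\hat\lambda^k+h(x^k)/\upsilon_k$; (5) if $V_k\le\tau V_{k-1}$, set $\upsilon_{k+1}=\upsilon_k$, $\varrho_{k+1}=\varrho_k$; otherwise set $\upsilon_{k+1}=\gamma\upsilon_k$, $\varrho_{k+1}=\eta\varrho_k/\gamma$. Approximately stationary point: a feasible point $\bar x$ of (NLP) for which there exist sequences $\{x^k\}\subseteq\mathbb R^n$, $\{\mu^k\}\subseteq\mathbb R^m_+$, $\{\lambda^k\}\subseteq\mathbb R^\ell$ (not necessarily those of the algorithm) such that $x^k\to\bar x$, $\nabla_xL(x^k,\mu^k,\lambda^k)\to0$, and $\max\{g_i(x^k),-\mu^k_i\}\to0$ for all $i\in\{1,\dots,m\}$. *)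

(* Defs.v *)
From mathcomp Require Import all_boot all_order all_algebra.
From mathcomp Require Import all_classical all_reals all_analysis.

Set Implicit Arguments.
Unset Strict Implicit.
Unset Printing Implicit Defensive.

Import Order.TTheory GRing.Theory Num.Theory.
Import numFieldNormedType.Exports.

Local Open Scope classical_set_scope.
Local Open Scope ring_scope.

Definition inner (R : realType) (n : nat) (u v : 'rV[R]_n) : R :=
  \sum_(i < n) u 0 i * v 0 i.

(* The library norm `|_| on 'rV[R]_n is the maximum norm, which induces the
   same topology but is not the norm used in the algorithm. *)
Definition enorm (R : realType) (n : nat) (u : 'rV[R]_n) : R :=
  Num.sqrt (inner u u).

Definition vmax (R : realType) (n : nat) (u v : 'rV[R]_n) : 'rV[R]_n :=
  \row_i Num.max (u 0 i) (v 0 i).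

Definition vmin (R : realType) (n : nat) (u v : 'rV[R]_n) : 'rV[R]_n :=
  \row_i Num.min (u 0 i) (v 0 i).

Definition gradient (R : realType) (n : nat) (f : 'rV[R]_n -> R)
    (x : 'rV[R]_n) : 'rV[R]_n :=
  \row_i 'D_(delta_mx 0 i) f x.

Definition C1_fun (R : realType) (n : nat) (f : 'rV[R]_n -> R) : Prop :=
  (forall x, differentiable f x) /\ continuous (gradient f).

Definition C1_map (R : realType) (n p : nat) (g : 'rV[R]_n -> 'rV[R]_p) : Prop :=
  (forall x, differentiable g x) /\ continuous (fun x => 'J g x).

Record nlp (R : realType) (n m l : nat) := Nlp {
  objective : 'rV[R]_n -> R;
  ineq : 'rV[R]_n -> 'rV[R]_m;
  equ : 'rV[R]_n -> 'rV[R]_l;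
  objective_C1 : C1_fun objective;
  ineq_C1 : C1_map ineq;
  equ_C1 : C1_map equ
}.

Definition feasible (R : realType) (n m l : nat) (P : nlp R n m l)
    (x : 'rV[R]_n) : Prop :=
  (forall i, ineq P x 0 i <= 0) /\ equ P x = 0.

Definition lagrangian (R : realType) (n m l : nat) (P : nlp R n m l)
    (x : 'rV[R]_n) (mu : 'rV[R]_m) (lambda : 'rV[R]_l) : R :=
  objective P x + inner mu (ineq P x) + inner lambda (equ P x).

Definition aug_lagrangian (R : realType) (n m l : nat) (P : nlp R n m l)
    (upsilon : R) (x : 'rV[R]_n) (mu : 'rV[R]_m) (lambda : 'rV[R]_l) : R :=
  objective P x
  + (2 * upsilon)^-1 * enorm (vmax 0 (ineq P x + upsilon *: mu)) ^+ 2
  + (2 * upsilon)^-1 * enorm (equ P x + upsilon *: lambda) ^+ 2.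

Definition approx_stationary (R : realType) (n m l : nat) (P : nlp R n m l)
    (xbar : 'rV[R]_n) : Prop :=
  feasible P xbar /\
  exists (x : nat -> 'rV[R]_n) (mu : nat -> 'rV[R]_m)
         (lambda : nat -> 'rV[R]_l),
    [/\ forall k i, 0 <= mu k 0 i,
        x @ \oo --> xbar,
        (fun k => gradient (fun y => lagrangian P y (mu k) (lambda k)) (x k))
          @ \oo --> (0 : 'rV[R]_n) &
        forall i, (fun k => Num.max (ineq P (x k) 0 i) (- mu k 0 i))
          @ \oo --> (0 : R)].

Record alm_data (R : realType) (m l : nat) := AlmData {
  upsilon0 : R;
  Yg : set 'rV[R]_m;
  Yh : set 'rV[R]_l;
  tau : R;
  gamma : R;
  eta : R;
  upsilon0_gt0 : 0 < upsilon0;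
  Yg_neq0 : Yg !=set0;
  Yg_compact : compact Yg;
  Yh_neq0 : Yh !=set0;
  Yh_compact : compact Yh;
  tau_itv : 0 < tau < 1;
  gamma_itv : 0 < gamma < 1;
  eta_itv : gamma < eta < Num.sqrt gamma
}.

Record alm_trace (R : realType) (n m l : nat) := AlmTrace {
  upsilon : nat -> R;
  varrho : nat -> R;
  muhat : nat -> 'rV[R]_m;
  lambdahat : nat -> 'rV[R]_l;
  xseq : nat -> 'rV[R]_n;
  zseq : nat -> 'rV[R]_m;
  Vseq : nat -> R;
  museq : nat -> 'rV[R]_m;
  lambdaseq : nat -> 'rV[R]_l
}.

(* [Vprev V k] is V_{k-1}, with V_{-1} = +oo. *)
Definition Vprev (R : realType) (V : nat -> R) (k : nat) : \bar R :=
  if k is j.+1 then (V j)%:E else +oo%E.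

(* The sense in which x^k approximately solves the k-th subproblem is left
   as the parameter [approx_sol k L x], read "x is an admissible approximate
   minimizer of L in iteration k". *)
Record generated_by_alm (R : realType) (n m l : nat) (P : nlp R n m l)
    (D : alm_data R m l)
    (approx_sol : nat -> ('rV[R]_n -> R) -> 'rV[R]_n -> Prop)
    (T : alm_trace R n m l) : Prop := GeneratedByAlm {
  alm_upsilon0 : upsilon T 0%N = upsilon0 D;
  alm_varrho0 : varrho T 0%N = 1;
  alm_muhat : forall k, [set varrho T k *: y | y in Yg D] (muhat T k);
  alm_lambdahat : forall k, [set varrho T k *: y | y in Yh D] (lambdahat T k);
  alm_x : forall k,
    approx_sol k
      (fun y => aug_lagrangian P (upsilon T k) y (muhat T k) (lambdahat T k))
      (xseq T k);
  alm_z : forall k,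
    zseq T k = vmin 0 (ineq P (xseq T k) + upsilon T k *: muhat T k);
  alm_V : forall k,
    Vseq T k = Num.max (enorm (ineq P (xseq T k) - zseq T k))
                       (enorm (equ P (xseq T k)));
  alm_mu : forall k,
    museq T k =
      muhat T k + (upsilon T k)^-1 *: (ineq P (xseq T k) - zseq T k);
  alm_lambda : forall k,
    lambdaseq T k = lambdahat T k + (upsilon T k)^-1 *: equ P (xseq T k);
  alm_keep : forall k,
    ((Vseq T k)%:E <= (tau D)%:E * Vprev (Vseq T) k)%E ->
    upsilon T k.+1 = upsilon T k /\ varrho T k.+1 = varrho T k;
  alm_update : forall k,
    ~ ((Vseq T k)%:E <= (tau D)%:E * Vprev (Vseq T) k)%E ->
    upsilon T k.+1 = gamma D * upsilon T k /\
    varrho T k.+1 = eta D * varrho T k / gamma D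
}.

(* Main.v *)
(* Since g - z = max(0, g + u muhat) - u muhat, the multipliers of the algorithm
   are mu = max(0, g + u muhat) / u >= 0 and lambda = lambdahat + h / u, and with
   these the gradient of the augmented Lagrangian at (x, muhat, lambdahat) is the
   gradient of the Lagrangian at (x, mu, lambda); so the latter tends to 0.
   For complementarity there are two cases. If the penalty parameter u is
   updated finitely often, V_k -> 0 geometrically and |max(g_i, -mu_i)| <= V_k.
   Otherwise u_k varrho_k is multiplied by eta < 1 infinitely often and tends to
   0, hence so does u_k muhat^k because Y^g is bounded; there one uses
   |max(g_i, -mu_i)| <= max(0, g_i) + |u muhat_i|, whose right-hand side tends to
   0 along a subsequence converging to the feasible point xbar. *)
Require Import Defs.
From mathcomp Require Import all_boot all_order all_algebra.
From mathcomp Require Import all_classical all_reals all_analysis.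
From mathcomp Require Import ring lra.

Import Order.TTheory GRing.Theory Num.Theory.
Import numFieldNormedType.Exports.

Local Open Scope classical_set_scope.
Local Open Scope ring_scope.

Set Implicit Arguments.
Unset Strict Implicit.
Unset Printing Implicit Defensive.

(** * Derivatives of separable functions of the constraint values *)

Lemma sqr_max0_taylor (R : realType) (t h : R) :
  `|Num.max 0 (h + t) ^+ 2 - Num.max 0 t ^+ 2 - 2 * Num.max 0 t * h| <= h ^+ 2.
Proof.
rewrite !maxEle ler_norml; case: (leP 0 (h + t)); case: (leP 0 t) => t0 ht0;
  apply/andP; split; nra.
Qed.

(** The kink of the positive part disappears on squaring: the first-order remainder is at most
    [h ^+ 2], so the difference quotient is off by at most [|h|], also at [t = 0]. *)
Lemma is_derive_sqr_max0 (R : realType) (t : R) :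
  is_derive t (1 : R) (fun s : R => Num.max 0 s ^+ 2) (2 * Num.max 0 t).
Proof.
suff lim : h^-1 *: (Num.max 0 (h *: 1 + t) ^+ 2 - Num.max 0 t ^+ 2)
    @[h --> (0 : R)^'] --> 2 * Num.max 0 t.
  split; last exact: (cvg_lim _ lim).
  by apply/cvg_ex; exists (2 * Num.max 0 t); exact: lim.
apply/cvgrPdist_le => e e0; near=> h.
have h0 : h != 0 by near: h; exact: nbhs_dnbhs_neq.
rewrite distrC /GRing.scale /= mulr1.
have -> : h^-1 * (Num.max 0 (h + t) ^+ 2 - Num.max 0 t ^+ 2) - 2 * Num.max 0 t
  = h^-1 * (Num.max 0 (h + t) ^+ 2 - Num.max 0 t ^+ 2 - 2 * Num.max 0 t * h).
  by field.
rewrite normrM normfV ler_pdivrMl ?normr_gt0//.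
apply: le_trans (sqr_max0_taylor _ _) _.
rewrite -real_normK ?num_real// expr2 ler_wpM2l//.
near: h; exact: dnbhs0_le.
Unshelve. all: by end_near. Qed.

Lemma is_derive_scalar_comp (R : realType) (n : nat) (phi : R -> R)
    (G : 'rV[R]_n -> R) (x v : 'rV[R]_n) (dphi : R) :
  differentiable G x -> is_derive (G x) (1 : R) phi dphi ->
  is_derive x v (phi \o G) (dphi * 'D_v G x).
Proof.
move=> dG [/derivable1_diffP dphiG phiE].
have dC : differentiable (phi \o G) x by exact: differentiable_comp.
split; first exact: diff_derivable.
rewrite (deriveE _ dC) diff_comp//= -(deriveE _ dG) diff1E//.
by rewrite derive1E phiE /GRing.scale /= mulrC.
Qed.

Lemma is_derive_sum_fct (R : realType) (n p : nat) (F : 'I_p -> 'rV[R]_n -> R)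
    (x v : 'rV[R]_n) (dF : 'I_p -> R) :
  (forall i, is_derive x v (F i) (dF i)) ->
  is_derive x v (fun y => \sum_i F i y) (\sum_i dF i).
Proof.
move=> dFx; have -> : (fun y => \sum_i F i y) = \sum_i F i.
  by apply/funext => y; rewrite fct_sumE.
exact: is_derive_sum.
Qed.

Lemma differentiable_entry (R : realType) (n p : nat)
    (g : 'rV[R]_n -> 'rV[R]_p) (x : 'rV[R]_n) (i : 'I_p) :
  differentiable g x -> differentiable (fun y => g y 0 i) x.
Proof.
move=> dg; apply: (@differentiable_comp _ _ _ _ g (fun N => N 0 i)) => //.
exact: differentiable_coord.
Qed.

(** Common shape of the Lagrangian and the augmented Lagrangian. Only the slopes [a] and [b] at the
    current constraint values enter the derivative, so two such functions with equal slopes have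
    equal gradients at [x]. *)
Lemma is_derive_separable (R : realType) (n m l : nat) (P : nlp R n m l)
    (phi : 'I_m -> R -> R) (psi : 'I_l -> R -> R) (a : 'I_m -> R)
    (b : 'I_l -> R) (x v : 'rV[R]_n) :
  (forall i, is_derive (ineq P x 0 i) (1 : R) (phi i) (a i)) ->
  (forall j, is_derive (equ P x 0 j) (1 : R) (psi j) (b j)) ->
  is_derive x v
    (fun y => objective P y + \sum_i phi i (ineq P y 0 i)
              + \sum_j psi j (equ P y 0 j))
    ('D_v (objective P) x + \sum_i a i * 'D_v (fun y => ineq P y 0 i) x
     + \sum_j b j * 'D_v (fun y => equ P y 0 j) x).
Proof.
move=> da db; apply: is_deriveD; first apply: is_deriveD.
- split=> //; apply: diff_derivable; exact: (proj1 (objective_C1 P)).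
- apply: is_derive_sum_fct => i.
  apply: (is_derive_scalar_comp _ (G := fun y => ineq P y 0 i)) (da i).
  apply: differentiable_entry; exact: (proj1 (ineq_C1 P)).
- apply: is_derive_sum_fct => j.
  apply: (is_derive_scalar_comp _ (G := fun y => equ P y 0 j)) (db j).
  apply: differentiable_entry; exact: (proj1 (equ_C1 P)).
Qed.

(** * Norm comparisons and the gradient identity *)

Lemma sqr_enorm (R : realType) (n : nat) (u : 'rV[R]_n) :
  enorm u ^+ 2 = \sum_i u 0 i ^+ 2.
Proof.
rewrite /enorm /inner sqr_sqrtr.
  by apply: eq_bigr => i _; rewrite expr2.
by apply: sumr_ge0 => i _; rewrite -expr2 sqr_ge0.
Qed.

Lemma enorm_ge0 (R : realType) (n : nat) (u : 'rV[R]_n) : 0 <= enorm u.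
Proof. exact: sqrtr_ge0. Qed.

Lemma entry_le_enorm (R : realType) (n : nat) (u : 'rV[R]_n) (i : 'I_n) :
  `|u 0 i| <= enorm u.
Proof.
rewrite -[leRHS]ger0_norm ?enorm_ge0// -ler_sqr ?nnegrE// !real_normK ?num_real//.
rewrite sqr_enorm (bigD1 i)//= lerDl sumr_ge0// => j _; exact: sqr_ge0.
Qed.

(** Convergence in ['rV[R]_n] is measured in the maximum norm, the tolerances [eps] in the Euclidean
    one. *)
Lemma mx_norm_le_enorm (R : realType) (n : nat) (u : 'rV[R]_n) :
  `|u| <= enorm u.
Proof.
rewrite [leLHS]mx_normrE; apply/bigmax_leP; split; first exact: enorm_ge0.
by case=> i j _ /=; rewrite ord1 entry_le_enorm.
Qed.

Lemma entry_le_mx_norm (R : realType) (n : nat) (u : 'rV[R]_n) (i : 'I_n) :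
  `|u 0 i| <= `|u|.
Proof.
rewrite [leRHS]mx_normrE.
exact: (le_bigmax _ (fun ij : 'I_1 * 'I_n => `|u ij.1 ij.2|) (0, i)).
Qed.

(** The multipliers on the right are frozen at [x] while [y] varies. The 2 from differentiating a
    square cancels the one in [(2 * u)^-1], so the slopes of the penalty terms are exactly these
    multipliers. *)
Lemma gradient_aug_lagrangian (R : realType) (n m l : nat) (P : nlp R n m l)
    (u : R) (x : 'rV[R]_n) (mu : 'rV[R]_m) (la : 'rV[R]_l) : 0 < u ->
  gradient (fun y => aug_lagrangian P u y mu la) x =
  gradient (fun y => lagrangian P y (u^-1 *: vmax 0 (ineq P x + u *: mu))
                                    (la + u^-1 *: equ P x)) x.
Proof.
move=> u0; apply/rowP => k; rewrite !mxE; set v := delta_mx 0 k.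
have u_neq0 : u != 0 by rewrite gt_eqF.
pose a i := u^-1 * Num.max 0 (ineq P x 0 i + u * mu 0 i).
pose b j := la 0 j + u^-1 * equ P x 0 j.
have augE : (fun y => aug_lagrangian P u y mu la) =
    (fun y => objective P y
      + \sum_i (2 * u)^-1 * Num.max 0 (ineq P y 0 i + u * mu 0 i) ^+ 2
      + \sum_j (2 * u)^-1 * (equ P y 0 j + u * la 0 j) ^+ 2).
  apply/funext => y; rewrite /aug_lagrangian !sqr_enorm !mulr_sumr.
  by congr (_ + _ + _); apply: eq_bigr => i _; rewrite !mxE.
have lagE : (fun y => lagrangian P y (u^-1 *: vmax 0 (ineq P x + u *: mu))
                                    (la + u^-1 *: equ P x)) =
    (fun y => objective P y + \sum_i a i * ineq P y 0 i
      + \sum_j b j * equ P y 0 j).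
  apply/funext => y; rewrite /lagrangian /inner.
  by congr (_ + _ + _); apply: eq_bigr => i _; rewrite !mxE.
have lin (c t : R) : is_derive t (1 : R) (fun s => c * s) c.
  by apply: is_derive_eq; rewrite /GRing.scale /= mulr1.
rewrite augE lagE.
(* Both functions are separable in the constraint values, with the same
   one-dimensional derivatives [a i] and [b j] at [x]. *)
rewrite (@derive_val _ _ _ _ _ _ _ (@is_derive_separable R n m l P
  (fun i s => a i * s) (fun j s => b j * s) a b x v _ _))//.
apply: (@derive_val _ _ _ _ _ _ _ (@is_derive_separable R n m l P
  (fun i s => (2 * u)^-1 * Num.max 0 (s + u * mu 0 i) ^+ 2)
  (fun j s => (2 * u)^-1 * (s + u * la 0 j) ^+ 2) a b x v _ _)).
- move=> i; set t := ineq P x 0 i; set c := u * mu 0 i.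
  have sh : is_derive t (1 : R) (fun s : R => s + c) 1.
    by apply: is_derive_eq; rewrite addr0.
  have sq := is_derive1_comp (g := fun s : R => s + c)
    (f := fun s : R => Num.max 0 s ^+ 2) (is_derive_sqr_max0 (t + c)) sh.
  apply: (@is_derive_eq _ _ _ _ _ _ _ _ (is_deriveZ (2 * u)^-1 sq)).
  by rewrite /GRing.scale /= /a -/t -/c; field.
- move=> j; apply: is_derive_eq.
  by rewrite /GRing.scale /= /b; field.
Qed.

(** * Subsequences and null sequences *)

Lemma cluster_subseq (R : realType) (n : nat) (x : nat -> 'rV[R]_n)
    (xbar : 'rV[R]_n) :
  cluster (x @ \oo) xbar ->
  exists2 f : nat -> nat, forall j, (j <= f j)%N & x \o f @ \oo --> xbar.
Proof.
move=> xcl.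
(* [f] need not be increasing: [j <= f j] already makes limits pass to [x \o f]. *)
have /choice[f fP] j : exists k, (j <= k)%N /\ `|xbar - x k| < j.+1%:R^-1.
  have tail : (x @ \oo) (x @` [set k | (j <= k)%N]).
    by exists j => // k /= jk; exists k.
  have e0 : 0 < j.+1%:R^-1 :> R by rewrite invr_gt0 ltr0n.
  have [_ [[k jk <-] xk]] := xcl _ _ tail (nbhsx_ballx xbar _ e0).
  exists k; split=> //; move: xk; rewrite -ball_normE; exact.
exists f => [j|]; first by have [] := fP j.
apply/cvgrPdist_le => e e0; near=> j.
have [_ /ltW xj] := fP j; apply: le_trans xj _.
apply: ltW; near: j; exact: (near_infty_natSinv_lt (PosNum e0)).
Unshelve. all: by end_near. Qed.

Lemma cvg_comp_ge (R : realType) (a : nat -> R) (f : nat -> nat) :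
  (forall j, (j <= f j)%N) -> a @ \oo --> (0 : R) ->
  a \o f @ \oo --> (0 : R).
Proof.
move=> jf /cvgrPdist_le a0; apply/cvgrPdist_le => e /a0 [N _ aN].
by exists N => // j /= Nj; apply: aN => /=; apply: leq_trans (jf j).
Qed.

(** Each contraction gains a factor [q], so by induction on [p] some term lies below [q ^+ p * s 0];
    monotonicity keeps all later terms there. *)
Lemma cvg0_contraction_io (R : realType) (q : R) (s : nat -> R) :
  0 <= q < 1 -> (forall k, 0 <= s k) -> (forall k, s k.+1 <= s k) ->
  (forall N, exists2 k, (N <= k)%N & s k.+1 <= q * s k) ->
  s @ \oo --> (0 : R).
Proof.
move=> /andP[q0 q1] s0 sS sq.
have snon j k : (j <= k)%N -> s k <= s j.
  move=> /subnK <-; elim: (k - j)%N => // d; exact: le_trans (sS _).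
have geo p : exists N, s N <= q ^+ p * s 0%N.
  elim: p => [|p [N sN]]; first by exists 0%N; rewrite mul1r.
  have [k Nk sk] := sq N; exists k.+1; apply: le_trans sk _.
  rewrite exprS -mulrA ler_wpM2l//; apply: le_trans sN; exact: snon.
have /cvgrPdist_le q_cvg : q ^+ p * s 0%N @[p --> \oo] --> (0 : R).
  rewrite -[X in _ --> X](mul0r (s 0%N)); apply: cvgMr_tmp.
  by apply: cvg_expr; rewrite ger0_norm.
apply/cvgrPdist_le => e /q_cvg [p _ /(_ p (leqnn p))].
rewrite sub0r normrN ger0_norm ?mulr_ge0 ?exprn_ge0// => qp.
have [N sN] := geo p; exists N => // k /= Nk.
rewrite sub0r normrN ger0_norm//.
by apply: le_trans qp; apply: le_trans sN; exact: snon.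
Qed.

Lemma cvg0_contraction_eventually (R : realType) (q : R) (s : nat -> R)
    (N : nat) :
  0 <= q < 1 -> (forall k, 0 <= s k) ->
  (forall k, (N <= k)%N -> s k.+1 <= q * s k) ->
  s @ \oo --> (0 : R).
Proof.
move=> q01 s0 sq; rewrite -(cvg_shiftn N).
have [q0 q1] := andP q01.
have sq' k : s (k.+1 + N)%N <= q * s (k + N)%N.
  by rewrite addSn; apply: sq; rewrite leq_addl.
apply: (@cvg0_contraction_io _ q) => // k; rewrite /=.
- exact: s0.
- by apply: le_trans (sq' k) _; rewrite ler_piMl// ltW.
- by exists k; [|exact: sq'].
Qed.

(** * Parameters and multipliers along the algorithm *)

Lemma eta_itv01 (R : realType) (m l : nat) (D : alm_data R m l) :
  0 < eta D < 1.
Proof.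
have /andP[g0 g1] := gamma_itv D; have /andP[ge es] := eta_itv D.
rewrite (lt_trans g0 ge)/=; apply: lt_le_trans es _.
by rewrite -sqrtr1 ler_wsqrtr// ltW.
Qed.

Lemma upsilon_varrho_gt0 (R : realType) (n m l : nat) (P : nlp R n m l)
    (D : alm_data R m l) (sol : nat -> ('rV[R]_n -> R) -> 'rV[R]_n -> Prop)
    (T : alm_trace R n m l) (T_alm : generated_by_alm P D sol T)
    (k : nat) :
  0 < upsilon T k /\ 0 < varrho T k.
Proof.
have /andP[g0 _] := gamma_itv D; have /andP[e0 _] := eta_itv01 D.
elim: k => [|k [u0 r0]].
  by rewrite (alm_upsilon0 T_alm) (alm_varrho0 T_alm) upsilon0_gt0.
have [/(alm_keep T_alm)[-> ->]//|/(alm_update T_alm)[-> ->]] :=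
  pselect ((Vseq T k)%:E <= (tau D)%:E * Vprev (Vseq T) k)%E.
by rewrite mulr_gt0// divr_gt0// mulr_gt0.
Qed.

Lemma Vseq_ge0 (R : realType) (n m l : nat) (P : nlp R n m l)
    (D : alm_data R m l) (sol : nat -> ('rV[R]_n -> R) -> 'rV[R]_n -> Prop)
    (T : alm_trace R n m l) (T_alm : generated_by_alm P D sol T)
    (k : nat) :
  0 <= Vseq T k.
Proof. by rewrite (alm_V T_alm) le_max enorm_ge0. Qed.

Lemma museqE (R : realType) (n m l : nat) (P : nlp R n m l)
    (D : alm_data R m l) (sol : nat -> ('rV[R]_n -> R) -> 'rV[R]_n -> Prop)
    (T : alm_trace R n m l) (T_alm : generated_by_alm P D sol T)
    (k : nat) :
  museq T k = (upsilon T k)^-1 *: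
    vmax 0 (ineq P (xseq T k) + upsilon T k *: muhat T k).
Proof.
have [u0 _] := upsilon_varrho_gt0 T_alm k.
rewrite (alm_mu T_alm) (alm_z T_alm); apply/rowP => i; rewrite !mxE.
set w := ineq P (xseq T k) 0 i + upsilon T k * _.
(* From [max 0 w + min 0 w = w]; the shift by [muhat] in the multiplier update then cancels. *)
have -> : Num.max 0 w = w - Num.min 0 w.
  by rewrite -[X in X - _]add0r -(addr_max_min 0 w) addrK.
by rewrite /w; field; rewrite gt_eqF.
Qed.

Lemma Vseq_or_upsilon_varrho_cvg0 (R : realType) (n m l : nat) (P : nlp R n m l)
    (D : alm_data R m l) (sol : nat -> ('rV[R]_n -> R) -> 'rV[R]_n -> Prop)
    (T : alm_trace R n m l) (T_alm : generated_by_alm P D sol T) :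
  Vseq T @ \oo --> (0 : R) \/
  (fun k => upsilon T k * varrho T k) @ \oo --> (0 : R).
Proof.
pose keep k := ((Vseq T k)%:E <= (tau D)%:E * Vprev (Vseq T) k)%E.
have /andP[g0 g1] := gamma_itv D; have /andP[e0 e1] := eta_itv01 D.
have /andP[t0 t1] := tau_itv D.
(* [gamma] cancels in the product of the two updates, leaving the factor [eta]. *)
have sE k : ~ keep k ->
    upsilon T k.+1 * varrho T k.+1 = eta D * (upsilon T k * varrho T k).
  move=> /(alm_update T_alm)[-> ->]; field; by rewrite gt_eqF.
have s0 k : 0 <= upsilon T k * varrho T k.
  by have [u0 r0] := upsilon_varrho_gt0 T_alm k; rewrite mulr_ge0 ?ltW.
have [[N kN]|noN] := pselect (exists N, forall k, (N <= k)%N -> keep k).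
- left; apply: (@cvg0_contraction_eventually _ (tau D) _ N).
  + by rewrite ltW.
  + exact: Vseq_ge0 T_alm.
  (* The test is read at [k.+1], where the previous value is the finite [Vseq T k] and never the
     initial [+oo]. *)
  + move=> k Nk; have := kN k.+1 (leqW Nk).
    by rewrite /keep /= -EFinM lee_fin.
- right; apply: (@cvg0_contraction_io _ (eta D)) => //.
  + by rewrite ltW.
  + move=> k; have [/(alm_keep T_alm)[-> ->]//|/sE->] := pselect (keep k).
    by rewrite ler_piMl// ltW.
  (* Without a contraction from [N] on, every iteration from [N] on would keep its parameters,
     against [noN]. *)
  + move=> N; apply: contrapT => noK; apply: noN; exists N => k Nk.
    by apply: contrapT => /sE sk; apply: noK; exists k; rewrite ?sk.
Qed.

(** * Bounds on the complementarity residual *)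

Lemma scaled_muhat_le (R : realType) (n m l : nat) (P : nlp R n m l)
    (D : alm_data R m l) (sol : nat -> ('rV[R]_n -> R) -> 'rV[R]_n -> Prop)
    (T : alm_trace R n m l) (T_alm : generated_by_alm P D sol T)
    (k : nat) (i : 'I_m) (M : R) :
  (forall y, Yg D y -> `|y| <= M) ->
  `|upsilon T k * muhat T k 0 i| <= upsilon T k * varrho T k * M.
Proof.
move=> YM; have [u0 r0] := upsilon_varrho_gt0 T_alm k.
have [y Yy <-] := alm_muhat T_alm k.
have s0 : 0 <= upsilon T k * varrho T k by rewrite mulr_ge0 ?ltW.
rewrite mxE mulrA normrM (ger0_norm s0) ler_wpM2l//.
exact: le_trans (entry_le_mx_norm _ _) (YM _ Yy).
Qed.

(** Let [c] be the entry of [upsilon *: muhat]. If [0 <= g + c], then [z = 0] and, as [- mu <= 0],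
    the maximum lies between [g] and [max 0 g], so its modulus is at most [|g| = |g - z|]. Otherwise
    [mu = 0] and [g - z = - c], which exceeds [g]. *)
Lemma complementarity_le_Vseq (R : realType) (n m l : nat) (P : nlp R n m l)
    (D : alm_data R m l) (sol : nat -> ('rV[R]_n -> R) -> 'rV[R]_n -> Prop)
    (T : alm_trace R n m l) (T_alm : generated_by_alm P D sol T)
    (k : nat) (i : 'I_m) :
  `|Num.max (ineq P (xseq T k) 0 i) (- museq T k 0 i)| <= Vseq T k.
Proof.
have [u0 _] := upsilon_varrho_gt0 T_alm k.
have := entry_le_enorm (ineq P (xseq T k) - zseq T k) i.
rewrite (alm_V T_alm) (museqE T_alm) (alm_z T_alm) !mxE.
set g := ineq P (xseq T k) 0 i; set c := upsilon T k * muhat T k 0 i => gz.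
rewrite le_max; apply/orP; left; apply: le_trans gz.
have [w0|w0] := leP 0 (g + c).
- have p0 : 0 <= (upsilon T k)^-1 * (g + c) by rewrite mulr_ge0// invr_ge0 ltW.
  rewrite subr0; have [gp|//] := leP g (- _).
  rewrite normrN ger0_norm// ler0_norm; lra.
- rewrite mulr0 oppr0; case: (leP g 0) => g0; first by rewrite normr0.
  rewrite gtr0_norm// ger0_norm; lra.
Qed.

(** If [0 <= g + c], then [- c <= g <= max g (- mu) <= max 0 g]. Otherwise [mu = 0] and the maximum
    equals [max 0 g]. *)
Lemma complementarity_le_shift (R : realType) (n m l : nat) (P : nlp R n m l)
    (D : alm_data R m l) (sol : nat -> ('rV[R]_n -> R) -> 'rV[R]_n -> Prop)
    (T : alm_trace R n m l) (T_alm : generated_by_alm P D sol T)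
    (k : nat) (i : 'I_m) :
  `|Num.max (ineq P (xseq T k) 0 i) (- museq T k 0 i)| <=
  Num.max 0 (ineq P (xseq T k) 0 i) + `|upsilon T k * muhat T k 0 i|.
Proof.
have [u0 _] := upsilon_varrho_gt0 T_alm k.
rewrite (museqE T_alm) !mxE.
set g := ineq P (xseq T k) 0 i; set c := upsilon T k * muhat T k 0 i.
have := ler_norm c; have := normr_ge0 c.
have [w0|w0] := leP 0 (g + c).
- have p0 : 0 <= (upsilon T k)^-1 * (g + c) by rewrite mulr_ge0// invr_ge0 ltW.
  rewrite ler_norml.
  by case: (leP g (- _)); case: (leP 0 g) => *; apply/andP; split; lra.
- rewrite mulr0 oppr0 maxC => *.
  rewrite ger0_norm ?le_max ?lexx// lerDl; lra.
Qed.

Theorem theorem3p8 (R : realType) (n m l : nat) (P : nlp R n m l)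
    (D : alm_data R m l) (eps : nat -> R) (T : alm_trace R n m l)
    (xbar : 'rV[R]_n)
    (eps_ge0 : forall k, 0 <= eps k)
    (eps_null : eps @ \oo --> (0 : R))
    (T_alm : generated_by_alm P D
       (fun k L x => enorm (gradient L x) <= eps k) T)
    (xbar_acc : cluster (xseq T @ \oo) xbar)
    (xbar_feas : feasible P xbar) :
  approx_stationary P xbar.
Proof.
have [f jf xf] := cluster_subseq xbar_acc.
split=> //; exists (xseq T \o f), (museq T \o f), (lambdaseq T \o f).
split=> //=.
- move=> k i; have [u0 _] := upsilon_varrho_gt0 T_alm (f k).
  by rewrite (museqE T_alm) !mxE mulr_ge0 ?le_max ?lexx// invr_ge0 ltW.
- have := cvg_comp_ge jf eps_null => /cvgrPdist_le eps0.
  apply/cvgrPdist_le => e /eps0; apply: filterS => k.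
  rewrite !sub0r !normrN ger0_norm//=; apply: le_trans.
  have [u0 _] := upsilon_varrho_gt0 T_alm (f k).
  apply: le_trans (mx_norm_le_enorm _) _.
  rewrite (museqE T_alm) (alm_lambda T_alm).
  rewrite -gradient_aug_lagrangian//; exact: (alm_x T_alm (f k)).
- move=> i; have [V0|s0] := Vseq_or_upsilon_varrho_cvg0 T_alm.
    apply: norm_cvg0; apply: squeeze_cvgr (cvg_comp_ge jf V0); last first.
      exact: cvg_cst.
    by near=> k; rewrite normr_ge0; exact: complementarity_le_Vseq T_alm _ _.
  (* Boundedness provides a bound for each real strictly above [M], hence [M + 1]. *)
  have [M [_ /(_ (M + 1))]] := compact_bounded (@Yg_compact _ _ _ D).
  rewrite ltrDl ltr01 => /(_ isT) YM.
  have g_cvg : ineq P (xseq T (f k)) 0 i @[k --> \oo] --> ineq P xbar 0 i.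
    apply: (cvg_comp (xseq T \o f) (fun y => ineq P y 0 i) xf).
    have /differentiable_entry dg := proj1 (ineq_C1 P) xbar.
    exact: (differentiable_continuous (dg i)).
  have gmax_cvg : Num.max 0 (ineq P (xseq T (f k)) 0 i) @[k --> \oo] --> (0 : R).
    (* By continuity the limit is [max 0] of the constraint at [xbar], and feasibility makes it
       0. *)
    have /max_idPl xbar_max : ineq P xbar 0 i <= 0 by case: xbar_feas.
    rewrite -[X in _ --> X]xbar_max.
    apply: (cvg_comp _ (fun t => Num.max 0 t) g_cvg).
    by apply: (@continuous_max R R (cst 0) id); [exact: cvg_cst|exact: cvg_id].
  apply: norm_cvg0.
  apply: (squeeze_cvgr (f := cst 0)
    (h := fun k => Num.max 0 (ineq P (xseq T (f k)) 0 i)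
                   + upsilon T (f k) * varrho T (f k) * (M + 1))).
  + near=> k; rewrite normr_ge0/=.
    apply: le_trans (complementarity_le_shift T_alm _ _) _.
    by rewrite lerD2l; exact: scaled_muhat_le T_alm _ _ _ YM.
  + exact: cvg_cst.
  + rewrite -[X in _ --> X]addr0; apply: cvgD gmax_cvg _.
    rewrite -[X in _ --> X](mul0r (M + 1)); apply: cvgMr_tmp.
    exact: cvg_comp_ge jf s0.
Unshelve. all: by end_near. Qed.
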